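(* Let $C_{(=,\neq)}(x,y)$ be the bivariate generating function of the Catalan words avoiding the ordered pair of relations $(=,\neq)$, where $x$ marks the length and $y$ marks the number of descents. Then $$C_{(=,\neq)}(x,y)=\frac{1 - x + 2 x y - 2 x^2 y - \sqrt{1 - 2 x + x^2 - 4 x^2 y}}{2 x y (1 - x)}.$$
   Context: A Catalan word of length $n$ is a word $w=w_1w_2\cdots w_n$ over the non-negative integers with $w_1=0$ and $0\leq w_i\leq w_{i-1}+1$ for $i=2,\dots,n$; the empty word is the unique Catalan word of length $0$. For relations $X,Y\in\{<,>,\leq,\geq,=,\neq\}$, a word $w$ contains the pattern $(X,Y)$ if there is an index $i\geq 1$ (with $i+2\le n$) such that $w_i\,X\,w_{i+1}$ and $w_{i+1}\,Y\,w_{i+2}$; otherwise $w$ avoids $(X,Y)$. The number of descents $\mathrm{des}(w)$ is the number of indices $i$ with $w_i>w_{i+1}$. The bivariate generating function is $C_{(X,Y)}(x,y)=\sum_{w}x^{|w|}y^{\mathrm{des}(w)}$, the sum being over all Catalan words $w$ (of any length $|w|\geq 0$) avoiding $(X,Y)$. Identities are between formal power series in $x$ with coefficients polynomials in $y$ (after clearing denominators); the square root of a power series with constant term $1$ is the one with constant term $1$. *)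

(* Defs.v *)
From HB Require Import structures.
From mathcomp Require Import all_boot all_order all_algebra.
From mathcomp Require Import boolp classical_sets.

Set Implicit Arguments.
Unset Strict Implicit.
Unset Printing Implicit Defensive.

Import GRing.Theory.
Local Open Scope ring_scope.

Record fps (R : Type) := Fps { coefs :> nat -> R }.

HB.instance Definition _ (R : Type) := gen_eqMixin (fps R).
HB.instance Definition _ (R : Type) := gen_choiceMixin (fps R).

Lemma fpsP (R : Type) (f g : fps R) : (forall n, f n = g n) <-> f = g.
Proof. by split=> [|->//]; case: f g => f [g] /= /funext ->. Qed.

Section FpsRing.
Variable R : comNzRingType.
Implicit Types (f g h : fps R) (n : nat).

Definition fps_zero : fps R := Fps (fun=> 0).
Definition fps_opp f : fps R := Fps (fun n => - f n).
Definition fps_add f g : fps R := Fps (fun n => f n + g n).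
Definition fps_const (c : R) : fps R := Fps (fun n => if n is 0 then c else 0).
Definition fps_mul f g : fps R := Fps (fun n => \sum_(i < n.+1) f i * g (n - i)%N).

Fact fps_addA : associative fps_add.
Proof. by move=> f g h; apply/fpsP=> n; rewrite /= addrA. Qed.
Fact fps_addC : commutative fps_add.
Proof. by move=> f g; apply/fpsP=> n; rewrite /= addrC. Qed.
Fact fps_add0 : left_id fps_zero fps_add.
Proof. by move=> f; apply/fpsP=> n; rewrite /= add0r. Qed.
Fact fps_addN : left_inverse fps_zero fps_opp fps_add.
Proof. by move=> f; apply/fpsP=> n; rewrite /= addNr. Qed.

HB.instance Definition _ := GRing.isZmodule.Build (fps R)
  fps_addA fps_addC fps_add0 fps_addN.

Let trunc n f : {poly R} := \poly_(i < n.+1) f i.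

Let mul_trunc n m f g : (m <= n)%N -> fps_mul f g m = (trunc n f * trunc n g)`_m.
Proof.
move=> le_mn; rewrite coefM; apply: eq_bigr => i _; rewrite !coef_poly !ltnS.
by rewrite (leq_trans (leq_subr i m) le_mn) (leq_trans _ le_mn) // -ltnS.
Qed.

Fact fps_mulC : commutative fps_mul.
Proof. by move=> f g; apply/fpsP=> n; rewrite !(mul_trunc _ _ (leqnn n)) mulrC. Qed.

Fact fps_mulA : associative fps_mul.
Proof.
move=> f g h; apply/fpsP=> n.
have mulL u v w : fps_mul (fps_mul u v) w n = (trunc n u * trunc n v * trunc n w)`_n.
  have le_in (i : 'I_n.+1) : (i <= n)%N by rewrite -ltnS.
  rewrite coefM; apply: eq_bigr => i _; rewrite (mul_trunc _ _ (le_in i)).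
  by rewrite coef_poly ltnS leq_subr.
by rewrite mulL fps_mulC mulL mulrC mulrA.
Qed.

Fact fps_mul1 : left_id (fps_const 1) fps_mul.
Proof.
move=> f; apply/fpsP=> n; rewrite /= big_ord_recl /= mul1r subn0.
by rewrite big1 ?addr0 // => i _; rewrite mul0r.
Qed.

Fact fps_mulDl : left_distributive fps_mul fps_add.
Proof.
move=> f g h; apply/fpsP=> n; rewrite /= -big_split.
by apply: eq_bigr => i _; rewrite mulrDl.
Qed.

Fact fps_oner_neq0 : fps_const 1 != 0.
Proof. by apply/eqP=> /fpsP/(_ 0%N)/eqP; rewrite /= oner_eq0. Qed.

HB.instance Definition _ := GRing.Zmodule_isComNzRing.Build (fps R)
  fps_mulA fps_mulC fps_mul1 fps_mulDl fps_oner_neq0.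

Definition fpsX : fps R := Fps (fun n => (n == 1%N)%:R).

Lemma coefs0 n : (0 : fps R) n = 0. Proof. by []. Qed.
Lemma coefsN f n : (- f) n = - f n. Proof. by []. Qed.
Lemma coefsD f g n : (f + g) n = f n + g n. Proof. by []. Qed.
Lemma coefs1 n : (1 : fps R) n = (n == 0%N)%:R. Proof. by case: n. Qed.
Lemma coefsM f g n : (f * g) n = \sum_(i < n.+1) f i * g (n - i)%N.
Proof. by []. Qed.

(* Junk value 0 when f has no square root with constant term 1. *)
Definition fps_sqrt f : fps R :=
  xget 0 [set g : fps R | g 0%N = 1 /\ g ^+ 2 = f]%classic.

End FpsRing.

Arguments fpsX {R}.

Section FpsSqrt.
Variable R : comUnitRingType.
Hypothesis unit2 : (2%:R : R) \is a GRing.unit.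
Implicit Types f g h : fps R.

Let coefs_sqrS g n : g 0%N = 1 ->
  (g ^+ 2) n.+1 = g n.+1 *+ 2 + \sum_(i < n) g i.+1 * g (n - i)%N.
Proof.
move=> g0; rewrite expr2 coefsM big_ord_recl big_ord_recr /= subn0 subnn g0.
by rewrite mul1r mulr1 addrCA -mulr2n addrC.
Qed.

Fixpoint fps_sqrt_seq f n : seq R :=
  if n is m.+1 then
    let s := fps_sqrt_seq f m in
    rcons s ((f m.+1 - \sum_(i < m) s`_i.+1 * s`_(m - i)) / 2%:R)
  else [:: 1].

Lemma fps_sqrt_ex f : f 0%N = 1 -> exists g, g 0%N = 1 /\ g ^+ 2 = f.
Proof.
move=> f0; pose s := fps_sqrt_seq f; pose g := Fps (fun n => (s n)`_n).
have sz n : size (s n) = n.+1 by elim: n => //= n IH; rewrite size_rcons IH.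
have sE n m : (m <= n)%N -> (s n)`_m = g m.
  elim: n => [|n IH]; first by case: m.
  rewrite leq_eqVlt ltnS => /predU1P[->//|le_mn].
  by rewrite /= nth_rcons sz ltnS le_mn IH.
have g0 : g 0%N = 1 by [].
exists g; split=> //; apply/fpsP => -[|n].
  by rewrite expr2 coefsM big_ord1 /= mul1r f0.
rewrite coefs_sqrS // [g n.+1]/= nth_rcons sz ltnn eqxx -[X in X + _]mulr_natr.
rewrite divrK // (eq_bigr (fun i : 'I_n => g i.+1 * g (n - i)%N)) ?subrK // => i _.
by rewrite !sE ?leq_subr.
Qed.

Lemma fps_sqrt_uniq f g h : g 0%N = 1 /\ g ^+ 2 = f -> h 0%N = 1 /\ h ^+ 2 = f -> g = h.
Proof.
move=> [g0 gf] [h0 hf]; apply/fpsP=> n; elim/ltn_ind: n => -[|n] IH.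
  by rewrite g0 h0.
have := congr1 (fun u : fps R => u n.+1) (etrans gf (esym hf)).
rewrite !coefs_sqrS // (eq_bigr (fun i : 'I_n => h i.+1 * h (n - i)%N)).
  by move/addIr; rewrite -[LHS]mulr_natr -[RHS]mulr_natr => /(mulIr unit2).
by move=> i _; rewrite !IH // !ltnS ?leq_subr.
Qed.

Lemma fps_sqrtP f : f 0%N = 1 -> fps_sqrt f 0%N = 1 /\ fps_sqrt f ^+ 2 = f.
Proof. by move=> /fps_sqrt_ex; apply: xgetPex. Qed.

Lemma fps_sqrt_unique f g : g 0%N = 1 -> g ^+ 2 = f -> fps_sqrt f = g.
Proof.
by move=> g0 gf; apply: xget_unique => // h hP; apply: (fps_sqrt_uniq hP).
Qed.

End FpsSqrt.

(* Words are indexed from 0: the letter w_(i+1) of the paper is nth 0 w i. *)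

Definition catalan (w : seq nat) : bool :=
  (head 0 w == 0)%N && sorted (fun a b => b <= a.+1)%N w.

Definition contains (X Y : rel nat) (w : seq nat) : bool :=
  has (fun i => X (nth 0 w i) (nth 0 w i.+1) && Y (nth 0 w i.+1) (nth 0 w i.+2))%N
      (iota 0 (size w - 2)).

Definition avoids (X Y : rel nat) (w : seq nat) : bool := ~~ contains X Y w.

Definition des (w : seq nat) : nat :=
  count (fun i => nth 0 w i.+1 < nth 0 w i)%N (iota 0 (size w).-1).

(* A Catalan word of length n only uses letters smaller than n, so summing over
   n.-tuple 'I_n below misses none of them. *)
Lemma catalan_lt_size w : catalan w -> all (fun a => a < size w)%N w.
Proof.
case: w => //= a w /andP[/eqP/= -> {a}] pw.
suff: all (fun b => b < (0 + size w).+1)%N w by [].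
elim: w 0%N pw => //= b w IH a /andP[leba /IH allw].
rewrite -addSnnS ltnS (leq_trans leba (leq_addr _ _)) /=.
by apply: sub_all allw => c /leq_trans; apply; rewrite ltnS leq_add2r.
Qed.

(* The series in x (fpsX) with coefficients in Q[y] (y is 'X). *)
Definition catalan_gf (X Y : rel nat) : fps {poly rat} :=
  Fps (fun n => \sum_(w : n.-tuple 'I_n |
                      catalan (map val w) && avoids X Y (map val w))
                  'X^(des (map val w))).

(* Main.v *)
(** Once a Catalan word avoiding (=, <>) repeats a letter, it is constant from
    there on; so a nonempty such word is a repeat-free one (no two consecutive
    letters equal) followed by copies of its last letter, and
    (1 - x) C = 1 - x + x E, where x E is the series of nonempty repeat-free
    words. Cutting a repeat-free word at its returns to 0 gives
    E = 1 + x E + x^2 y E^2, so that 1 - x - 2 x^2 y E is the square root of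
    (1 - x)^2 - 4 x^2 y with constant term 1. *)
Require Import Defs.
From mathcomp Require Import all_boot all_order all_algebra.
From mathcomp Require Import ring.
Set Implicit Arguments.
Unset Strict Implicit.
Unset Printing Implicit Defensive.

Import GRing.Theory.
Local Open Scope ring_scope.

(** * Repeat-free words and their quadratic equation *)

Section RepeatFreeContinuations.
Variables (R : comNzRingType) (y : R).

(* Weight, by y^des, of the words of length k that can follow a letter a without
   two consecutive letters being equal (including a). *)
Fixpoint rfree_cont (k a : nat) : R :=
  if k is k'.+1 then rfree_cont k' a.+1 + y * \sum_(b < a) rfree_cont k' b
  else 1.

Definition rfree_series (a : nat) : fps R := Fps (rfree_cont^~ a).

Local Notation x := (fpsX : fps R).
Local Notation yy := (fps_const y).
Local Notation F := rfree_series.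

Lemma coefs_fpsXM (f : fps R) n : (x * f) n = if n is m.+1 then f m else 0.
Proof.
rewrite coefsM; case: n => [|n]; first by rewrite big_ord1 /= mul0r.
rewrite big_ord_recl /= mul0r add0r big_ord_recl /= mul1r subSS subn0.
by rewrite big1 ?addr0 // => i _; rewrite mul0r.
Qed.

Lemma coefs_fps_constM (c : R) (f : fps R) n : (fps_const c * f) n = c * f n.
Proof.
rewrite coefsM big_ord_recl /= subn0 big1 ?addr0 // => i _.
by rewrite mul0r.
Qed.

Lemma coefs_sum (I : finType) (f : I -> fps R) n :
  (\sum_i f i) n = \sum_i f i n.
Proof. exact: (big_morph (fun g : fps R => g n)). Qed.

(** Continuations of [a] that are empty or start with a descent to some [b < a]. *)
Let G (a : nat) : fps R := 1 + x * yy * \sum_(b < a) F b.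

Let FE a : F a = G a + x * F a.+1.
Proof.
apply/fpsP => n; rewrite !coefsD -mulrA !coefs_fpsXM coefs1.
case: n => [|n]; first by rewrite !addr0.
by rewrite add0r coefs_fps_constM coefs_sum addrC.
Qed.

Let F0E : F 0 = 1 + x * F 1.
Proof. by rewrite FE /G big_ord0 mulr0 addr0. Qed.

Let GS a : G a.+1 = G a + x * yy * F a.
Proof. by rewrite /G big_ord_recr /= mulrDr addrA. Qed.

Let G1 : G 1 = 1 + x * yy * F 0.
Proof. by rewrite GS /G big_ord0 mulr0 addr0. Qed.

(* A continuation from a splits at its first letter below a: the part before it
   is a translate of a continuation from 0. The proof shows instead that both
   sides solve the same recurrence: their difference D satisfies a homogeneous
   equation D = x * (...), hence vanishes at every order. *)
Let F_factor a : F a = F 0 * G a.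
Proof.
pose D b := F b - F 0 * G b.
have DE b : D b = x * (D b.+1 - D 1%N * G b + x * yy * F 0 * D b).
  rewrite /D {1}(FE b) {1}F0E G1 GS.
  by ring.
suff D0 k : forall b m, (m < k)%N -> D b m = 0.
  by apply/eqP; rewrite -subr_eq0; apply/eqP/fpsP => n; apply: (D0 n.+1).
clearbody D; elim: k => // k IH b [|m]; rewrite DE coefs_fpsXM // ltnS => lt_mk.
have IHle c i : (i <= m)%N -> D c i = 0.
  by move=> le_im; apply: IH; apply: leq_ltn_trans lt_mk.
rewrite !coefsD coefsN IHle // (coefsM (D 1%N)) (coefsM _ (D b)).
rewrite !big1 ?oppr0 ?addr0 // => i _.
  by rewrite IHle ?mulr0 ?leq_subr.
by rewrite IHle ?mul0r // -ltnS.
Qed.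

(** Combines [F 0 = 1 + x * F 1] with the factorization [F 1 = F 0 * G 1]. *)
Lemma rfree_series0_eq :
  F 0 = 1 + x * F 0 + x ^+ 2 * yy * F 0 ^+ 2.
Proof. by rewrite {1}F0E (F_factor 1) G1; ring. Qed.

End RepeatFreeContinuations.

Lemma fps_sqrt_rfree (R : comUnitRingType) (y : R) :
  (2%:R : R) \is a GRing.unit ->
  let x : fps R := fpsX in
  fps_sqrt (1 - 2%:R * x + x ^+ 2 - 4%:R * x ^+ 2 * fps_const y) =
    1 - x - 2%:R * x ^+ 2 * fps_const y * rfree_series y 0.
Proof.
move=> unit2 x; apply: fps_sqrt_unique => //.
  rewrite !(coefsD, coefsN) (_ : _ * _ * _ * _ =
    x * (2%:R * x * fps_const y * rfree_series y 0)); last by ring.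
  by rewrite coefs_fpsXM coefs1 /= !subr0.
set E := rfree_series y 0; set c := fps_const y.
have EE : E = 1 + x * E + x ^+ 2 * c * E ^+ 2 := rfree_series0_eq y.
(* Completing the square isolates [E - (x * E + x ^+ 2 * c * E ^+ 2)], which [EE] turns into 1. *)
have -> : (1 - x - 2%:R * x ^+ 2 * c * E) ^+ 2 =
   (1 - x) ^+ 2 - 4%:R * x ^+ 2 * c * (E - (x * E + x ^+ 2 * c * E ^+ 2)).
  by ring.
by rewrite {1}EE -[1 + _ + _]addrA addrK; ring.
Qed.

(** * Avoidance and descents, letter by letter *)

Local Notation Avoids := (avoids (fun a b => a == b) (fun a b => a != b)).
Local Notation step := (fun a b : nat => (b <= a.+1)%N).

Lemma contains_cons3 X Y a b c w :
  contains X Y [:: a, b, c & w] =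
    (X a b && Y b c) || contains X Y [:: b, c & w].
Proof.
rewrite /contains /= !subSS !subn0 /=.
congr (_ || _).
by rewrite (iotaDl 1 0) has_map.
Qed.

Lemma des_cons2 a b w : des [:: a, b & w] = ((b < a) + des (b :: w))%N.
Proof. by rewrite /des /= (iotaDl 1 0) count_map. Qed.

Lemma avoids_cons_neq a b w : a != b -> Avoids [:: a, b & w] = Avoids (b :: w).
Proof.
move=> neq_ab; case: w => [|c w] //.
by rewrite /avoids contains_cons3 (negPf neq_ab).
Qed.

(** After a repeat, the first letter other than [a] would complete an occurrence of the pattern. *)
Lemma avoids_cons_eq a w : Avoids [:: a, a & w] = all (pred1 a) w.
Proof.
elim: w => [|b w IH] //; rewrite /avoids contains_cons3 eqxx /= negb_or negbK.
by rewrite eq_sym; case: eqP => //= ->.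
Qed.

Lemma path_step_constant a w : all (pred1 a) w -> path step a w.
Proof. by elim: w => //= b w IH /andP[/eqP-> /IH->]; rewrite leqnSn. Qed.

Lemma des_constant a w : all (pred1 a) w -> des (a :: w) = 0%N.
Proof.
by elim: w => //= b w IH /andP[/eqP-> /IH]; rewrite des_cons2 ltnn.
Qed.

(** * Summing weights over all continuations *)

Section Weights.
Variables (R : comNzRingType) (y : R).

(** The value 0 on inadmissible words lets sums range over all tuples. *)
Definition cont_weight a w : R :=
  if path step a w && Avoids (a :: w) then y ^+ des (a :: w) else 0.

Lemma cont_weight_cons a b w :
  cont_weight a (b :: w) =
    if (b <= a.+1)%N then
      if b == a then (all (pred1 a) w)%:R else y ^+ (b < a)%N * cont_weight b w
    else 0.
Proof.
rewrite /cont_weight /= des_cons2; case: (b <= a.+1)%N => //=.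
case: eqVneq => [->|neq_ba].
  rewrite avoids_cons_eq; have [cw|] := boolP (all _ _); last by rewrite andbF.
  by rewrite path_step_constant // des_constant // ltnn.
rewrite avoids_cons_neq 1?eq_sym //; case: ifP => _; last by rewrite mulr0.
by rewrite exprD.
Qed.

Lemma big_tuple_cons (T : finType) k (f : k.+1.-tuple T -> R) :
  \sum_t f t = \sum_(b : T) \sum_(t : k.-tuple T) f [tuple of b :: t].
Proof.
rewrite pair_bigA /= (reindex (fun p : T * k.-tuple T => [tuple of p.1 :: p.2])) //.
exists (fun t => (thead t, [tuple of behead t])) => [[b t] _|t _] /=.
  by congr (_, _); apply: val_inj.
by rewrite -tuple_eta.
Qed.

Lemma big_tuple0 (T : finType) (f : 0.-tuple T -> R) : \sum_t f t = f [tuple].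
Proof.
rewrite (big_pred1 [tuple]) // => t; apply/esym/eqP.
exact: tuple0.
Qed.

Lemma sum_constant_tuples N k (a : 'I_N) :
  \sum_(t : k.-tuple 'I_N) (all (pred1 (a : nat)) (map val t))%:R = 1 :> R.
Proof.
elim: k => [|k IH]; first by rewrite big_tuple0.
rewrite big_tuple_cons (bigD1 a) //= eqxx IH big1 ?addr0 // => b neq_ba.
by rewrite big1 // => t _; rewrite /= val_eqE (negPf neq_ba).
Qed.

(** Here [j] is the length of the repeat-free part; the other [k - j] letters copy its last letter
    and add no descent. Letters never exceed [a + k], so the alphabet ['I_N] misses none. *)
Lemma sum_cont_weight N k a : (a + k < N)%N ->
  \sum_(t : k.-tuple 'I_N) cont_weight a (map val t) =
    \sum_(j < k.+1) rfree_cont y j a.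
Proof.
elim: k a => [|k IH] a; first by rewrite big_tuple0 big_ord1.
rewrite addnS => lt_akN; rewrite big_tuple_cons.
pose S b := \sum_(t : k.-tuple 'I_N) cont_weight a (b :: map val t).
have lt_aN : (a.+1 < N)%N by apply: leq_ltn_trans lt_akN; rewrite ltnS leq_addr.
have -> : \sum_(b < N) S b = \sum_(b < a.+2) S b.
  rewrite (big_ord_widen _ S lt_aN) [RHS]big_mkcond; apply: eq_bigr => b _.
  rewrite ltnS; case: leqP => // lt_ab; rewrite /S big1 // => t _.
  by rewrite cont_weight_cons leqNgt lt_ab.
(* Repeating [a] at once forces a constant word: this is the term [j = 0]. *)
have Sa : S a = 1.
  rewrite -(sum_constant_tuples k (Ordinal (ltnW lt_aN))).
  by apply: eq_bigr => t _; rewrite cont_weight_cons leqnSn eqxx.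
have SaS : S a.+1 = \sum_(j < k.+1) rfree_cont y j a.+1.
  rewrite -IH ?addSn //; apply: eq_bigr => t _.
  by rewrite cont_weight_cons leqnn gtn_eqF // ltnNge leqnSn expr0 mul1r.
have Sb (b : 'I_a) : S b = y * \sum_(j < k.+1) rfree_cont y j b.
  rewrite -IH; last first.
    by apply: leq_ltn_trans (ltnW lt_akN); rewrite leq_add2r ltnW.
  rewrite mulr_sumr; apply: eq_bigr => t _.
  by rewrite cont_weight_cons ltn_ord ltn_eqF // (leq_trans (ltnW (ltn_ord b))) // expr1.
rewrite [LHS]big_ord_recr /= [X in X + _]big_ord_recr /= Sa SaS (eq_bigr _ (fun b _ => Sb b)).
rewrite -mulr_sumr exchange_big /= [RHS]big_ord_recl /=.
rewrite big_split /= -mulr_sumr.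
by ring.
Qed.

End Weights.

(** * The generating function *)

Local Notation gf := (catalan_gf (fun a b => a == b) (fun a b => a != b)).

Lemma catalan_gf_0 X Y : catalan_gf X Y 0%N = 1.
Proof.
rewrite /= (big_pred1 [tuple]) // => t; rewrite [t]tuple0.
exact/esym/eqP.
Qed.

Lemma catalan_gf_eq_neqS n :
  gf n.+1 = \sum_(j < n.+1) rfree_cont ('X : {poly rat}) j 0.
Proof.
rewrite -(@sum_cont_weight _ _ n.+1) // /= big_mkcond big_tuple_cons.
(* Only words with first letter 0 are Catalan. *)
rewrite big_ord_recl [X in _ + X]big1 ?addr0 => [|b _]; last first.
  by rewrite big1.
by apply: eq_bigr => t _; rewrite /catalan /cont_weight.
Qed.

(** Multiplying by [1 - fpsX] takes differences of consecutive partial sums. *)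
Lemma catalan_gf_eq_neq :
  (1 - fpsX) * gf = 1 - fpsX + fpsX * rfree_series ('X : {poly rat}) 0.
Proof.
rewrite mulrBl mul1r; apply/fpsP => -[|n].
  by rewrite !coefsD !coefsN !coefs_fpsXM catalan_gf_0 coefs1 /= !subr0 addr0.
rewrite !coefsD !coefsN !coefs_fpsXM coefs1 catalan_gf_eq_neqS.
(* Degree 1 is apart: the empty word gives [gf 0 = 1], not an empty partial sum, whence the extra
   [1 - fpsX]. *)
case: n => [|n]; first by rewrite big_ord1 catalan_gf_0 /= add0r addNr subrr.
by rewrite catalan_gf_eq_neqS big_ord_recr /= [LHS]addrAC subrr subr0.
Qed.

(* Denominators are cleared: 2 x y (1 - x) is not a unit among power series. *)
Theorem theorem3p10 :
  let x : fps {poly rat} := fpsX in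
  let y : fps {poly rat} := fps_const 'X in
  let C := catalan_gf (fun a b => a == b) (fun a b => a != b) in
  2%:R * x * y * (1 - x) * C =
    1 - x + 2%:R * x * y - 2%:R * x ^+ 2 * y
      - fps_sqrt (1 - 2%:R * x + x ^+ 2 - 4%:R * x ^+ 2 * y).
Proof.
move=> x y C.
rewrite fps_sqrt_rfree; last by rewrite poly_unitE -polyC_natr size_polyC coefC.
by rewrite -mulrA catalan_gf_eq_neq -/x -/y; ring.
Qed.
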